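(* Consider the setting and Batching SVRG algorithm described in the context, with step sizes $\sigma_\theta = \frac{\lambda_{\min}}{6\kappa(Q)^2 L_G^2}$ and $\sigma_\omega = \beta\sigma_\theta$, where $\beta = \frac{8\lambda_{\max}(\hat A^\top \hat C^{-1}\hat A)}{\lambda_{\min}(\hat C)}$, and number of inner iterations $K = \frac{2}{\sigma_\theta\lambda_{\min}} = \frac{12\kappa(Q)^2L_G^2}{\lambda_{\min}^2}$. Assume $\hat A$ is nonsingular and $\hat C$ is positive definite. Then for every epoch $m$, $$\mathbb{E}\|Q^{-1}\Delta_{m+1}\|^2 \le \frac{2}{3}\,\mathbb{E}\|Q^{-1}\Delta_m\|^2 + 2\,\frac{1-\sigma_\theta\lambda_{\min}}{\lambda_{\min}^2}\,\mathbb{E}\|Q^{-1}e_m\|^2 .$$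
   Context: Data: $n$ transitions $(s_t,a_t,r_t,s_{t+1})$, $t\in[n]=\{1,\dots,n\}$, a feature map $\phi$ from states to $\mathbb{R}^d$ and a discount factor $\gamma$. Define $\hat A_t=\phi(s_t)(\phi(s_t)-\gamma\phi(s_{t+1}))^\top$, $\hat b_t=r_t\phi(s_t)$, $\hat C_t=\phi(s_t)\phi(s_t)^\top$, and let $\hat A,\hat b,\hat C$ be their averages over $t\in[n]$. Under the assumption that $\hat A$ is nonsingular and $\hat C$ positive definite, the saddle-point problem $\min_\theta\max_\omega \langle \hat b-\hat A\theta,\omega\rangle-\frac12\omega^\top\hat C\omega$ (equivalent to minimizing the empirical MSPBE $\frac12\|\hat A\theta-\hat b\|^2_{\hat C^{-1}}$) has the unique solution $(\theta^\star,\omega^\star)=(\hat A^{-1}\hat b,0)$. Let $\beta=\frac{8\lambda_{\max}(\hat A^\top\hat C^{-1}\hat A)}{\lambda_{\min}(\hat C)}$. For $t\in[n]$ set $G_t=\begin{pmatrix}0&-\sqrt\beta\hat A_t^\top\\ \sqrt\beta\hat A_t&\beta\hat C_t\end{pmatrix}$, $g_t=\begin{pmatrix}0\\ \sqrt\beta\hat b_t\end{pmatrix}$, and let $G=\frac1n\sum_t G_t$, $g=\frac1n\sum_t g_t$. Put $z^\star=(\theta^\star,\omega^\star/\sqrt\beta)$; then $Gz^\star=g$. With this $\beta$, $G$ is diagonalizable with all eigenvalues real and positive; fix a factorization $G=Q\Lambda Q^{-1}$ with $\Lambda$ diagonal. $\lambda_{\min}$ denotes the smallest eigenvalue of $G$;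 $\|\cdot\|$ is the Euclidean norm for vectors and the spectral norm for matrices; $\kappa(Q)=\|Q\|\|Q^{-1}\|$; $L_G^2=\left\|\frac1n\sum_{t=1}^n G_t^\top G_t\right\|$. Batching SVRG (written in the coordinates $z=(\theta,\omega/\sqrt\beta)$, with step sizes $\sigma_\theta$ for $\theta$ and $\sigma_\omega=\beta\sigma_\theta$ for $\omega$): at the start of epoch $m$ the current iterate is $z_m$. A subset $\mathcal B_m\subseteq[n]$ of size $B_m$ is sampled uniformly at random, and $G_m=\frac1{B_m}\sum_{t\in\mathcal B_m}G_t$, $g_m=\frac1{B_m}\sum_{t\in\mathcal B_m}g_t$. Set $z_{m,0}=z_m$ and for $j=0,\dots,K-1$ sample $t_j$ uniformly from $[n]$ (independently of everything else) and set $z_{m,j+1}=z_{m,j}-\sigma_\theta\big(G_{t_j}z_{m,j}+(G_m-G_{t_j})z_m-g_m\big)$; then $z_{m+1}=z_{m,K}$. Define $\Delta_m=z_m-z^\star$ and the mini-batch error $e_m=(Gz_m-g)-(G_mz_m-g_m)$. Expectations are over all randomness of the algorithm. *)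

(* Defs.v *)
From HB Require Import structures.
From mathcomp Require Import all_boot all_order all_algebra.
From mathcomp Require Import boolp classical_sets reals.
Set Implicit Arguments. Unset Strict Implicit. Unset Printing Implicit Defensive.
Import Order.TTheory GRing.Theory Num.Theory.
Local Open Scope ring_scope.
Local Open Scope classical_set_scope.

Section LinAlg.
Variable R : realType.

Definition enorm k (v : 'cV[R]_k) : R := Num.sqrt (\sum_i v i 0 ^+ 2).

Definition opnorm p q (M : 'M[R]_(p, q)) : R :=
  sup [set enorm (M *m v) | v in [set v : 'cV[R]_q | enorm v = 1]].

Definition kappa k (M : 'M[R]_k) : R := opnorm M * opnorm (invmx M).

Definition lam_max k (M : 'M[R]_k) : R := sup [set a : R | eigenvalue M a].
Definition lam_min k (M : 'M[R]_k) : R := inf [set a : R | eigenvalue M a].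

Definition posdef k (M : 'M[R]_k) : Prop :=
  forall v : 'cV[R]_k, v != 0 -> 0 < (v^T *m M *m v) 0 0.

End LinAlg.

Section Problem.
Variable R : realType.
Variables (n d : nat).
(* phi t := phi(s_t), phi' t := phi(s_{t+1}), rw t := r_t *)
Variables (phi phi' : 'I_n -> 'cV[R]_d) (rw : 'I_n -> R) (gamma : R).

Definition Ahat_t (t : 'I_n) : 'M[R]_d := phi t *m (phi t - gamma *: phi' t)^T.
Definition bhat_t (t : 'I_n) : 'cV[R]_d := rw t *: phi t.
Definition Chat_t (t : 'I_n) : 'M[R]_d := phi t *m (phi t)^T.

Definition Ahat : 'M[R]_d := n%:R^-1 *: \sum_t Ahat_t t.
Definition bhat : 'cV[R]_d := n%:R^-1 *: \sum_t bhat_t t.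
Definition Chat : 'M[R]_d := n%:R^-1 *: \sum_t Chat_t t.

Definition beta : R :=
  8 * lam_max ((Ahat)^T *m invmx Chat *m Ahat) / lam_min Chat.

Definition G_t (t : 'I_n) : 'M[R]_(d + d) :=
  block_mx 0 (- (Num.sqrt beta *: (Ahat_t t)^T))
           (Num.sqrt beta *: Ahat_t t) (beta *: Chat_t t).
Definition g_t (t : 'I_n) : 'cV[R]_(d + d) :=
  col_mx 0 (Num.sqrt beta *: bhat_t t).

Definition Gbar : 'M[R]_(d + d) := n%:R^-1 *: \sum_t G_t t.
Definition gbar : 'cV[R]_(d + d) := n%:R^-1 *: \sum_t g_t t.

Definition LG2 : R := opnorm (n%:R^-1 *: \sum_t ((G_t t)^T *m G_t t)).

(* z* = (theta*, omega*/sqrt beta) = (Ahat^{-1} bhat, 0) *)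
Definition zstar : 'cV[R]_(d + d) := col_mx (invmx Ahat *m bhat) 0.

Definition Gbatch (S : {set 'I_n}) : 'M[R]_(d + d) :=
  #|S|%:R^-1 *: \sum_(t in S) G_t t.
Definition gbatch (S : {set 'I_n}) : 'cV[R]_(d + d) :=
  #|S|%:R^-1 *: \sum_(t in S) g_t t.

(* randomness of one epoch: the mini-batch B_m and the inner indices t_0..t_{K-1} *)
Definition epoch_rand (K : nat) : finType := ({set 'I_n} * K.-tuple 'I_n)%type.

Definition epoch_step (sigma : R) (K : nat) (z : 'cV[R]_(d + d))
    (w : epoch_rand K) : 'cV[R]_(d + d) :=
  foldl (fun zj t =>
           zj - sigma *: (G_t t *m zj + (Gbatch w.1 - G_t t) *m z - gbatch w.1))
        z w.2.

Fixpoint traj (sigma : R) (K : nat) (z0 : 'cV[R]_(d + d))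
    (om : nat -> epoch_rand K) (m : nat) : 'cV[R]_(d + d) :=
  match m with
  | 0 => z0
  | m'.+1 => epoch_step sigma (traj sigma z0 om m') (om m')
  end.

Definition err (sigma : R) (K : nat) (z0 : 'cV[R]_(d + d))
    (om : nat -> epoch_rand K) (m : nat) : 'cV[R]_(d + d) :=
  let zm := traj sigma z0 om m in
  (Gbar *m zm - gbar) - (Gbatch (om m).1 *m zm - gbatch (om m).1).

Definition Omega (K m : nat) : finType := {ffun 'I_m.+1 -> epoch_rand K}.

(* batches have the prescribed sizes B_k; the uniform distribution on the valid
   outcomes is the product of the uniform laws of the algorithm *)
Definition valid (K : nat) (B : nat -> nat) (m : nat) : pred (Omega K m) :=
  fun w => [forall k : 'I_m.+1, #|(w k).1| == B k].

Definition ext (K m : nat) (w : Omega K m) : nat -> epoch_rand K :=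
  fun k => w (inord k).

End Problem.

Definition Exp (R : realType) (T : finType) (P : pred T) (X : T -> R) : R :=
  (\sum_(w | P w) X w) / #|[pred w | P w]|%:R.

(* Main.v *)
(* In the coordinates x = Q^-1 (z - zstar) the mean drift of an inner step is the
   diagonal contraction x |-> (1 - sigma Lam) x + sigma Q^-1 e_m, whose square is
   at most (1-s)|x|^2 + (s/lmin^2)|Q^-1 e_m|^2 with s = sigma lmin <= 1/6, by
   convexity. The variance of the step is at most
   sigma^2 kappa(Q)^2 L_G^2 |x - x_0|^2 <= (s/3)(|x|^2 + |x_0|^2), so that
   a_j = E|x_j|^2 satisfies
     a_{j+1} <= (1 - 2s/3) a_j + (s/3) a_0 + (s/lmin^2) |Q^-1 e_m|^2.
   Iterating K = 2/s times, with (1 - 2s/3)^K <= 1/3, gives the factor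
   1/2 + 1/2 * 1/3 = 2/3 on a_0, and 3/2 <= 2(1-s) on the error term. *)
Require Import Defs.
From HB Require Import structures.
From mathcomp Require Import all_boot all_order all_algebra.
From mathcomp Require Import boolp classical_sets reals.
From mathcomp Require Import ring lra.
From mathcomp Require complex.
Import Order.TTheory GRing.Theory Num.Theory.
Set Implicit Arguments. Unset Strict Implicit. Unset Printing Implicit Defensive.
Local Open Scope ring_scope.

(** * Euclidean norm and spectral norm *)

Section SqNorm.
Variable R : realType.

Definition sqnorm k (v : 'cV[R]_k) : R := \sum_i v i 0 ^+ 2.

Lemma sqnorm_ge0 k (v : 'cV[R]_k) : 0 <= sqnorm v.
Proof. by apply: sumr_ge0 => i _; apply: sqr_ge0. Qed.

Lemma enorm_ge0 k (v : 'cV[R]_k) : 0 <= enorm v.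
Proof. exact: sqrtr_ge0. Qed.

Lemma enorm_sqr k (v : 'cV[R]_k) : enorm v ^+ 2 = sqnorm v.
Proof. by rewrite sqr_sqrtr ?sqnorm_ge0. Qed.

Lemma sqnorm_eq0 k (v : 'cV[R]_k) : (sqnorm v == 0) = (v == 0).
Proof.
apply/idP/eqP => [|->]; last first.
  by rewrite /sqnorm big1 // => i _; rewrite mxE expr0n.
rewrite psumr_eq0 => [/allP v0|i _]; last exact: sqr_ge0.
apply/colP => i; rewrite mxE; apply/eqP.
by have := v0 i (mem_index_enum i); rewrite sqrf_eq0.
Qed.

Lemma enorm_eq0 k (v : 'cV[R]_k) : (enorm v == 0) = (v == 0).
Proof. by rewrite -sqnorm_eq0 -enorm_sqr sqrf_eq0. Qed.

Lemma sqnormE k (v : 'cV[R]_k) : sqnorm v = (v^T *m v) 0 0.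
Proof. by rewrite mxE; apply: eq_bigr => i _; rewrite mxE expr2. Qed.

Lemma sqnormZ k a (v : 'cV[R]_k) : sqnorm (a *: v) = a ^+ 2 * sqnorm v.
Proof. by rewrite mulr_sumr; apply: eq_bigr => i _; rewrite mxE exprMn. Qed.

Lemma enormZ k a (v : 'cV[R]_k) : 0 <= a -> enorm (a *: v) = a * enorm v.
Proof.
move=> a0; rewrite {1}/enorm -/(sqnorm _) sqnormZ.
by rewrite sqrtrM ?sqr_ge0// sqrtr_sqr ger0_norm.
Qed.

Lemma sqnormB_le k (u v : 'cV[R]_k) :
  sqnorm (u - v) <= 2 * (sqnorm u + sqnorm v).
Proof.
rewrite /sqnorm -big_split /= mulr_sumr; apply: ler_sum => i _.
rewrite !mxE; have := sqr_ge0 (u i 0 + v i 0); nra.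
Qed.

(** Bias-variance split: the cross terms are linear in [y t], hence sum to zero. *)
Lemma sum_sqnorm_centered n k (a : 'cV[R]_k) (y : 'I_n -> 'cV[R]_k) :
  \sum_t y t = 0 ->
  \sum_t sqnorm (a + y t) = n%:R * sqnorm a + \sum_t sqnorm (y t).
Proof.
move=> y0; rewrite /sqnorm exchange_big [in RHS]exchange_big /= mulr_sumr.
rewrite -big_split /=; apply: eq_bigr => i _.
have yi0 : \sum_t y t i 0 = 0 by rewrite -summxE y0 mxE.
under eq_bigr => t _ do rewrite mxE sqrrD -addrA.
rewrite !big_split /= sumr_const card_ord mulr_natl; congr (_ + _).
by rewrite -mulr_sumr yi0 mulr0 !add0r.
Qed.

Section OpNorm.
Variables p q : nat.
Implicit Type M : 'M[R]_(p, q).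

Lemma opnorm_has_ubound M :
  has_ubound [set enorm (M *m v) | v in [set v : 'cV[R]_q | enorm v = 1]].
Proof.
(* Each entry of a unit vector is at most 1 in absolute value, so a coordinate of [M *m v] is
   bounded by the absolute row sum. *)
exists (Num.sqrt (\sum_i (\sum_j `|M i j|) ^+ 2)) => _ [v /= v1 <-].
apply: ler_wsqrtr; apply: ler_sum => i _; rewrite -real_normK ?num_real//.
rewrite lerXn2r ?nnegrE ?sumr_ge0//.
rewrite mxE (le_trans (ler_norm_sum _ _ _))//; apply: ler_sum => j _.
rewrite normrM ler_piMr//.
rewrite -(@ler_pXn2r _ 2)// ?nnegrE// real_normK ?num_real// expr1n.
suff <- : sqnorm v = 1.
  by rewrite /sqnorm (bigD1 j)//= lerDl sumr_ge0// => l _; apply: sqr_ge0.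
by rewrite -enorm_sqr v1 expr1n.
Qed.

Lemma opnorm_ge0 M : 0 <= opnorm M.
Proof.
rewrite /opnorm; set E := (X in sup X).
(* For [q = 0] there is no unit vector, and the supremum of the empty set is 0 by default. *)
have [->|/set0P [x Ex]] := eqVneq E set0; first by rewrite sup0.
apply: le_trans (ub_le_sup (opnorm_has_ubound M) Ex).
by case: Ex => v _ <-; apply: enorm_ge0.
Qed.

Lemma enorm_mulmx_le M v : enorm (M *m v) <= opnorm M * enorm v.
Proof.
have [->|v0] := eqVneq v 0.
  rewrite mulmx0 (_ : enorm 0 = 0) ?mulr_ge0 ?opnorm_ge0 ?enorm_ge0//.
  by apply/eqP; rewrite enorm_eq0.
have ev : 0 < enorm v by rewrite lt0r enorm_eq0 v0 enorm_ge0.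
rewrite -ler_pdivrMr// mulrC -enormZ ?invr_ge0 ?enorm_ge0// scalemxAr.
apply: ub_le_sup; first exact: opnorm_has_ubound.
exists ((enorm v)^-1 *: v) => //=.
by rewrite enormZ ?invr_ge0 ?enorm_ge0// mulVf ?gt_eqF.
Qed.

Lemma sqnorm_mulmx_le M v : sqnorm (M *m v) <= opnorm M ^+ 2 * sqnorm v.
Proof.
rewrite -!enorm_sqr -exprMn lerXn2r ?nnegrE ?mulr_ge0 ?opnorm_ge0 ?enorm_ge0//.
exact: enorm_mulmx_le.
Qed.

End OpNorm.

(** With c the spectral norm, expanding the square of c v - M v gives 2c v^T M v <= c^2 |v|^2 + |M
    v|^2 <= 2 c^2 |v|^2. Dividing by 2c needs c > 0, so c = 0 is treated apart. *)
Lemma quad_form_le k (M : 'M[R]_k) v :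
  (v^T *m M *m v) 0 0 <= opnorm M * sqnorm v.
Proof.
have : (v^T *m M *m v) 0 0 = \sum_i v i 0 * (M *m v) i 0.
  by rewrite -mulmxA mxE; apply: eq_bigr => i _; rewrite mxE.
move=> ->; have [c0|c0] := eqVneq (opnorm M) 0.
  have Mv0 : M *m v = 0.
    apply/eqP; rewrite -sqnorm_eq0 eq_le sqnorm_ge0 andbT.
    by rewrite (le_trans (sqnorm_mulmx_le M v))// c0 expr0n mul0r.
  by rewrite c0 mul0r big1 // => i _; rewrite Mv0 mxE mulr0.
have cp : 0 < opnorm M by rewrite lt0r c0 opnorm_ge0.
have H := sqnorm_mulmx_le M v.
rewrite -(ler_pM2l cp) -(ler_pM2l (ltr0Sn R 1)).
apply: (@le_trans _ _ (opnorm M ^+ 2 * sqnorm v + sqnorm (M *m v))).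
  rewrite /sqnorm !mulr_sumr -big_split /=; apply: ler_sum => i _.
  have := sqr_ge0 (opnorm M * v i 0 - (M *m v) i 0); nra.
lra.
Qed.

Lemma kappa_ge1 k (Q : 'M[R]_k) : (0 < k)%N -> Q \in unitmx -> 1 <= kappa Q.
Proof.
case: k Q => // k Q _ Qu.
pose v : 'cV[R]_k.+1 := delta_mx 0 0.
have v0 : 0 < enorm v.
  rewrite lt0r enorm_eq0 enorm_ge0 andbT; apply/eqP => /matrixP/(_ 0 0)/eqP.
  by rewrite !mxE !eqxx oner_eq0.
rewrite -(ler_pM2r v0) mul1r -[X in enorm X <= _](mulKVmx Qu).
apply: le_trans (enorm_mulmx_le _ _) _; rewrite -mulrA ler_wpM2l ?opnorm_ge0//.
exact: enorm_mulmx_le.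
Qed.

End SqNorm.

(** * Real symmetric matrices have a real eigenvalue *)

Lemma symmetric_eigenvalue_real (C : numClosedFieldType) k (M : 'M[C]_k) c :
  M^T = M -> (forall i j, M i j \is Num.real) -> eigenvalue M c ->
  c \is Num.real.
Proof.
move=> MT Mr /eigenvalueP[v vM v0].
(* [h] is the Hermitian form of [M] at [v]. It equals c |v|^2, and it is self-conjugate because [M]
   is real and symmetric, so [c] is a quotient of reals. *)
pose h := \sum_j (v *m M) 0 j * (v 0 j)^*.
have hE : h = c * \sum_j `|v 0 j| ^+ 2.
  rewrite /h vM mulr_sumr; apply: eq_bigr => j _.
  by rewrite mxE -mulrA normCK.
have hC : h^* = h.
  rewrite /h rmorph_sum /=.
  under eq_bigr => j _ do rewrite mxE rmorphM /= conjCK rmorph_sum mulr_suml.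
  rewrite exchange_big; apply: eq_bigr => j _ /=.
  rewrite mxE mulr_suml; apply: eq_bigr => i _.
  have Mij : M i j = M j i by rewrite -[in LHS]MT mxE.
  by rewrite rmorphM /= (conj_Creal (Mr _ _)) Mij; ring.
have sp : 0 < \sum_j `|v 0 j| ^+ 2.
  rewrite lt0r sumr_ge0 ?andbT => [|j _]; last by rewrite exprn_ge0.
  apply: contraNneq v0 => s0; apply/eqP/rowP => j; rewrite mxE.
  move/eqP: s0; rewrite psumr_eq0 => [/allP/(_ j (mem_index_enum j))|l _].
    by rewrite sqrf_eq0 normr_eq0 => /eqP.
  by rewrite exprn_ge0.
have -> : c = h / \sum_j `|v 0 j| ^+ 2 by rewrite hE mulfK ?gt_eqF.
by rewrite rpred_div ?(gtr0_real sp)//; apply/CrealP.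
Qed.

Section SymmetricEigenvalue.
Import complex.

(** An eigenvalue exists over the complex closure and is real by the previous lemma. It makes the
    spectra behind [lam_min] and [lam_max] nonempty, without which [inf] and [sup] would take
    default values. *)
Lemma symmetric_eigenvalue (R : rcfType) k (M : 'M[R]_k) :
  (0 < k)%N -> M^T = M -> exists a, eigenvalue M a.
Proof.
move=> k0 MT; pose f : {rmorphism R -> R[i]} := real_complex R.
have [c cM] := eigenvalue_closed (map_mx f M) k0.
have /complex_realP[a ca] : c \is Num.real.
  apply: symmetric_eigenvalue_real cM.
    by apply/matrixP => i j; rewrite !mxE -[in RHS]MT mxE.
  by move=> i j; rewrite mxE; apply/complex_realP; exists (M i j).
by exists a; rewrite -(eigenvalue_map f) /= -ca.
Qed.

End SymmetricEigenvalue.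

(** * Extreme eigenvalues and positive definite matrices *)

Section Spectrum.
Variable R : realType.
Implicit Type k : nat.

Lemma eigenvalue_col k (M : 'M[R]_k) a : eigenvalue M a ->
  exists2 v : 'cV[R]_k, v^T *m M = a *: v^T & v != 0.
Proof.
move=> /eigenvalueP[v vM v0]; exists v^T; rewrite ?trmxK//.
by apply: contraNneq v0 => /(congr1 trmx); rewrite trmxK trmx0 => ->.
Qed.

Lemma sqnorm_gt0 k (v : 'cV[R]_k) : (0 < sqnorm v) = (v != 0).
Proof. by rewrite lt0r sqnorm_eq0 sqnorm_ge0 andbT. Qed.

Lemma enorm_gt0 k (v : 'cV[R]_k) : (0 < enorm v) = (v != 0).
Proof. by rewrite lt0r enorm_eq0 enorm_ge0 andbT. Qed.

(** Eigenvectors are row vectors here, whence the transpose. The bound makes the spectrum of a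
    matrix, and that of its inverse, bounded above. *)
Lemma eigenvalue_le_opnorm k (M : 'M[R]_k) a :
  eigenvalue M a -> a <= opnorm M^T.
Proof.
move=> /eigenvalue_col[v vM v0]; have [a0|/ltW a0] := lerP a 0.
  by rewrite (le_trans a0) ?opnorm_ge0.
have ev : 0 < enorm v by rewrite enorm_gt0.
rewrite -(ler_pM2r ev) -enormZ//.
have -> : a *: v = M^T *m v by rewrite -[v]trmxK -trmx_mul vM linearZ /= trmxK.
exact: enorm_mulmx_le.
Qed.

Lemma lam_max_gt0 k (M : 'M[R]_k) a : eigenvalue M a -> 0 < a -> 0 < lam_max M.
Proof.
move=> Ma a0; apply: lt_le_trans a0 _; apply: ub_le_sup => //.
by exists (opnorm M^T) => b; apply: eigenvalue_le_opnorm.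
Qed.

Lemma lam_min_le k (M : 'M[R]_k) a :
  (forall b, eigenvalue M b -> 0 < b) -> eigenvalue M a -> lam_min M <= a.
Proof. by move=> M0 Ma; apply: ge_inf => //; exists 0 => b /M0 /ltW. Qed.

Lemma eigenvalue0_unitmx k (M : 'M[R]_k) : ~~ eigenvalue M 0 -> M \in unitmx.
Proof.
by rewrite /eigenvalue /eigenspace negbK raddf0 subr0 kermx_eq0 row_free_unit.
Qed.

Lemma lam_min_gt0 k (M : 'M[R]_k) :
  (exists a, eigenvalue M a) -> (forall b, eigenvalue M b -> 0 < b) ->
  0 < lam_min M.
Proof.
move=> [a Ma] M0.
have Mu : M \in unitmx.
  by apply: eigenvalue0_unitmx; apply/negP => /M0; rewrite ltxx.
(* The inverse of an eigenvalue is an eigenvalue of the inverse matrix, so the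
   spectrum is bounded away from 0. *)
have inv_le b : eigenvalue M b -> b^-1 <= opnorm (invmx M)^T.
  move=> Mb; apply: eigenvalue_le_opnorm; have b0 := M0 _ Mb.
  case/eigenvalueP: Mb => v vM v0; apply/eigenvalueP; exists v => //.
  by rewrite -[v in RHS](mulmxK Mu) vM -scalemxAl scalerA mulVf ?gt_eqF// scale1r.
have c0 : 0 < opnorm (invmx M)^T.
  by apply: lt_le_trans (inv_le _ Ma); rewrite invr_gt0 M0.
apply: (@lt_le_trans _ _ (opnorm (invmx M)^T)^-1); first by rewrite invr_gt0.
apply: lb_le_inf; first by exists a.
move=> b /= Mb; have b0 := M0 _ Mb.
by rewrite -[leRHS]invrK lef_pV2 ?posrE ?invr_gt0// inv_le.
Qed.

Lemma posdef_eigenvalue_gt0 k (M : 'M[R]_k) a :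
  posdef M -> eigenvalue M a -> 0 < a.
Proof.
move=> Mp /eigenvalue_col[v vM v0]; have := Mp v v0.
by rewrite vM -scalemxAl mxE -sqnormE pmulr_lgt0 // sqnorm_gt0.
Qed.

Lemma posdef_unitmx k (M : 'M[R]_k) : posdef M -> M \in unitmx.
Proof.
move=> Mp; apply: eigenvalue0_unitmx; apply/negP => /(posdef_eigenvalue_gt0 Mp).
by rewrite ltxx.
Qed.

Lemma posdef_spectrum k (M : 'M[R]_k) :
  (0 < k)%N -> M^T = M -> posdef M -> 0 < lam_min M /\ 0 < lam_max M.
Proof.
move=> k0 MT Mp; have [a Ma] := symmetric_eigenvalue k0 MT.
split; last exact: lam_max_gt0 Ma (posdef_eigenvalue_gt0 Mp Ma).
by apply: lam_min_gt0; [exists a | move=> b; apply: posdef_eigenvalue_gt0].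
Qed.

(** With u = C^-1 A v, the form at v equals u^T C u. *)
Lemma posdef_congr k (A C : 'M[R]_k) : A \in unitmx -> C^T = C -> posdef C ->
  posdef (A^T *m invmx C *m A).
Proof.
move=> Au CT Cp v v0; have Cu := posdef_unitmx Cp.
pose u := invmx C *m (A *m v).
have CuE : C *m u = A *m v by rewrite mulKVmx.
have u0 : u != 0.
  apply: contraNneq v0 => u0; move: CuE; rewrite u0 mulmx0 => Av0.
  by rewrite -(mulKmx Au v) -Av0 mulmx0.
have := Cp u u0; congr (_ < _ 0 0).
by rewrite -[in LHS]CT -trmx_mul CuE trmx_mul /u !mulmxA.
Qed.

End Spectrum.

(** * The saddle-point matrix: block form, fixed point, positive spectrum *)

Lemma sum_block_mx (V : nmodType) (I : finType) p1 p2 q1 q2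
    (A : I -> 'M[V]_(p1, q1)) (B : I -> 'M[V]_(p1, q2))
    (C : I -> 'M[V]_(p2, q1)) (D : I -> 'M[V]_(p2, q2)) :
  \sum_t block_mx (A t) (B t) (C t) (D t)
  = block_mx (\sum_t A t) (\sum_t B t) (\sum_t C t) (\sum_t D t).
Proof.
elim: (index_enum I) => [|t s IH]; first by rewrite !big_nil block_mx0.
by rewrite !big_cons IH add_block_mx.
Qed.

Lemma sum_col_mx (V : nmodType) (I : finType) p1 p2 q
    (A : I -> 'M[V]_(p1, q)) (B : I -> 'M[V]_(p2, q)) :
  \sum_t col_mx (A t) (B t) = col_mx (\sum_t A t) (\sum_t B t).
Proof.
elim: (index_enum I) => [|t s IH]; first by rewrite !big_nil col_mx0.
by rewrite !big_cons IH add_col_mx.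
Qed.

Lemma scaler_sumrA (R : comPzRingType) (V : lmodType R) (I : finType) (a b : R)
    (F : I -> V) :
  a *: (\sum_t b *: F t) = b *: (a *: \sum_t F t).
Proof. by rewrite -scaler_sumr !scalerA mulrC. Qed.

(** For an eigenvector v = (x, y) the skew off-diagonal blocks cancel in the quadratic form, leaving
    a |v|^2 = b y^T C y. Moreover y is nonzero: otherwise the second block equation gives A x = 0,
    so x = 0. *)
Lemma saddle_eigenvalue_gt0 (R : realType) d (A C : 'M[R]_d) s b a :
  A \in unitmx -> posdef C -> s != 0 -> 0 < b ->
  eigenvalue (block_mx 0 (- (s *: A^T)) (s *: A) (b *: C)) a -> 0 < a.
Proof.
move=> Au Cp sb b0 /eigenvalue_col[v vG v0].
have [x [y vE]] : exists x y, v = col_mx x y.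
  by exists (usubmx v), (dsubmx v); rewrite vsubmxK.
move: vG; rewrite vE tr_col_mx mul_row_block !mulmx0 add0r.
rewrite scale_row_mx => /eq_row_mx[ex ey].
have y0 : y != 0.
  apply: contraNneq v0 => y0; move: ey.
  rewrite y0 !trmx0 mul0mx addr0 scaler0 mulmxN -scalemxAr => /eqP.
  rewrite oppr_eq0 scaler_eq0 (negPf sb) /= -trmx_mul => /eqP/(congr1 trmx).
  rewrite trmxK trmx0 => Ax0; rewrite vE y0.
  by rewrite -(mulKmx Au x) Ax0 mulmx0 col_mx0.
(* Transposing a 1 by 1 matrix identifies y^T A x with x^T A^T y, which cancels the cross terms. *)
have tr11 (M : 'M[R]_1) : M^T = M by apply/matrixP => i j; rewrite mxE !ord1.
have : (a *: x^T) *m x + (a *: y^T) *m y = b *: (y^T *m C *m y).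
  rewrite -ex -ey mulmxDl addrA mulmxN mulNmx -!scalemxAr -!scalemxAl.
  by rewrite -[y^T *m A *m x]tr11 !trmx_mul trmxK mulmxA subrr add0r.
have -> : (a *: x^T) *m x + (a *: y^T) *m y = a *: (v^T *m v).
  by rewrite vE tr_col_mx mul_row_col scalerDr !scalemxAl.
move=> /matrixP/(_ 0 0); rewrite mxE [RHS]mxE -sqnormE.
move=> E; rewrite -(pmulr_lgt0 _ (_ : 0 < sqnorm v)) ?sqnorm_gt0// E.
by rewrite mulr_gt0 // Cp.
Qed.

Section SaddlePoint.
Variable R : realType.
Variables (n d : nat).
Variables (phi phi' : 'I_n -> 'cV[R]_d) (rw : 'I_n -> R) (gamma : R).

Local Notation A := (Ahat phi phi' gamma).
Local Notation C := (Chat phi).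
Local Notation b := (beta phi phi' gamma).
Local Notation G := (Gbar phi phi' gamma).
Local Notation Gt := (G_t phi phi' gamma).

Lemma Gbar_block :
  G = block_mx 0 (- (Num.sqrt b *: A^T)) (Num.sqrt b *: A) (b *: C).
Proof.
rewrite /Gbar /G_t sum_block_mx scale_block_mx big1 // scaler0.
rewrite sumrN scalerN !scaler_sumrA; congr block_mx.
by rewrite /Ahat [(_ *: _)^T]linearZ /= [(\sum_t _)^T]raddf_sum.
Qed.

Lemma gbar_block : gbar phi phi' rw gamma = col_mx 0 (Num.sqrt b *: bhat phi rw).
Proof.
by rewrite /gbar /g_t sum_col_mx scale_col_mx big1 // scaler0 scaler_sumrA.
Qed.

Lemma Gbar_zstar : A \in unitmx ->
  G *m zstar phi phi' rw gamma = gbar phi phi' rw gamma.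
Proof.
move=> Au; rewrite Gbar_block gbar_block mul_block_col !mulmx0 mul0mx !addr0.
by rewrite -scalemxAl mulKVmx.
Qed.

Lemma Chat_sym : C^T = C.
Proof.
rewrite /Chat linearZ /= raddf_sum; congr (_ *: _).
by apply: eq_bigr => t _; rewrite /Chat_t /= trmx_mul trmxK.
Qed.

Hypothesis Au : A \in unitmx.
Hypothesis Cp : posdef C.

Lemma beta_gt0 : (0 < d)%N -> 0 < b.
Proof.
move=> d0; have [lC _] := posdef_spectrum d0 Chat_sym Cp.
have Hp := posdef_congr Au Chat_sym Cp.
have [|_ lH] := posdef_spectrum d0 _ Hp.
  by rewrite !trmx_mul trmxK trmx_inv Chat_sym mulmxA.
by rewrite /beta divr_gt0 ?mulr_gt0.
Qed.

Lemma Gbar_eigenvalue_gt0 a : (0 < d)%N -> eigenvalue G a -> 0 < a.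
Proof.
move=> /beta_gt0 b0; rewrite Gbar_block; apply: saddle_eigenvalue_gt0 => //.
by rewrite gt_eqF ?sqrtr_gt0.
Qed.

(** The average of |G_t v|^2 is the quadratic form at v of the matrix whose spectral norm is
    [LG2]. *)
Lemma mean_sqnorm_G_t v : (0 < n)%N ->
  \sum_t sqnorm (Gt t *m v) <= n%:R * (LG2 phi phi' gamma * sqnorm v).
Proof.
move=> n0; rewrite -ler_pdivrMl ?ltr0n//.
apply: le_trans (quad_form_le _ v).
rewrite le_eqVlt; apply/orP; left; apply/eqP.
rewrite -scalemxAr -scalemxAl mxE; congr (_ * _).
rewrite mulmx_sumr mulmx_suml summxE; apply: eq_bigr => t _.
by rewrite sqnormE trmx_mul !mulmxA.
Qed.

End SaddlePoint.

(** * Averages, iterated contraction and scalar inequalities *)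

Lemma sum_sqnorm_mean (R : realType) n k (y : 'I_n -> 'cV[R]_k) :
  (0 < n)%N -> let m := n%:R^-1 *: \sum_t y t in
  \sum_t sqnorm (y t) = n%:R * sqnorm m + \sum_t sqnorm (y t - m).
Proof.
move=> n0 m; rewrite -sum_sqnorm_centered.
  by apply: eq_bigr => t _; rewrite addrC subrK.
rewrite sumrB sumr_const card_ord -scaler_nat scalerA mulfV ?scale1r ?subrr//.
by rewrite pnatr_eq0 -lt0n.
Qed.

Lemma big_tuple_cons (V : nmodType) (T : finType) K (F : K.+1.-tuple T -> V) :
  \sum_(w : K.+1.-tuple T) F w
  = \sum_(t : T) \sum_(w : K.-tuple T) F [tuple of t :: w].
Proof.
rewrite pair_big /=.
rewrite (reindex (fun p : T * K.-tuple T => [tuple of p.1 :: p.2])) //=.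
exists (fun w => (thead w, [tuple of behead w])) => [[t w] _|w _] /=.
  by congr pair; apply: val_inj.
by rewrite [RHS]tuple_eta.
Qed.

(** The hypothesis says that the average of V - c shrinks by the factor r, so K steps shrink it by
    r^K. Induction splits off the first index of the tuple, the one [foldl] consumes first. *)
Lemma sum_foldl_contraction (R : realType) (T : finType) (X : Type)
    (f : X -> T -> X) (V : X -> R) (r c : R) K x :
  0 <= r ->
  (forall x, \sum_t V (f x t) <= #|T|%:R * (r * V x + (1 - r) * c)) ->
  \sum_(w : K.-tuple T) V (foldl f x w)
  <= #|T|%:R ^+ K * (r ^+ K * V x + (1 - r ^+ K) * c).
Proof.
move=> r0 fV; elim: K x => [|K IH] x.
  rewrite !expr0 subrr mul0r addr0 !mul1r.
  rewrite (eq_bigr (fun=> V x)) => [|w _]; last by rewrite (tuple0 w).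
  by rewrite sumr_const card_tuple expn0 mulr1n.
rewrite big_tuple_cons /=; apply: le_trans (ler_sum _ (fun t _ => IH (f x t))) _.
rewrite -mulr_sumr big_split /= -mulr_sumr sumr_const -[X in _ + X]mulr_natl.
rewrite [X in _ <= X * _]exprSr -mulrA ler_wpM2l ?exprn_ge0//.
have := ler_wpM2l (exprn_ge0 K r0) (fV x); rewrite exprS; lra.
Qed.

Lemma expr_le_third (R : realFieldType) (s : R) K :
  0 < s -> s <= 1 / 6 -> K%:R * s = 2 -> (1 - 2 / 3 * s) ^+ K <= 1 / 3.
Proof.
move=> s0 s6 Ks; pose a := 2 / 3 * s.
(* [(1 - a)(1 + a) <= 1], with [(1 + a)^j] truncated at second order. *)
have bound j : (1 - a) ^+ j *
    (1 + j%:R * a + j%:R * (j%:R - 1) / 2 * a ^+ 2) <= 1.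
  elim: j => [|j IH]; first by rewrite expr0; lra.
  apply: le_trans IH; rewrite exprSr -mulrA ler_wpM2l ?exprn_ge0//.
    by rewrite /a; lra.
  rewrite -natr1; move: (j%:R : R) (ler0n R j) => y y0.
  have a0 : 0 <= a by rewrite /a; lra.
  (* The exact gap between the bracket at j and 1 - a times the bracket at j + 1. *)
  have : 0 <= a ^+ 2 + y * (y + 1) / 2 * a ^+ 3.
    by rewrite addr_ge0 ?mulr_ge0 ?exprn_ge0 ?invr_ge0 ?addr_ge0 ?ler0n ?ler01 ?(ltW s0).
  lra.
have := bound K.
have q0 : 0 <= (1 - a) ^+ K by rewrite exprn_ge0// /a; lra.
(* Since K a = 4/3, the bracket is 3 + (2/9 - 4/9 s), which is at least 3 because s <= 1/2. *)
have -> : 1 + K%:R * a + K%:R * (K%:R - 1) / 2 * a ^+ 2 = 1 + 4/3 + 8/9 - 4/9 * s.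
  have : K%:R = 2 / s by rewrite -Ks mulfK ?gt_eqF.
  by rewrite /a => ->; field; rewrite gt_eqF.
have : 0 <= (1 - a) ^+ K * (2 / 9 - 4 / 9 * s) by rewrite mulr_ge0//; lra.
rewrite -/a; lra.
Qed.

Lemma convex_step (R : realFieldType) (l sg L x e : R) :
  0 < l -> 0 < sg -> l <= L -> sg * L <= 1 ->
  (x - sg * (L * x - e)) ^+ 2 <= (1 - sg * l) * x ^+ 2 + sg / l * e ^+ 2.
Proof.
(* Rescaling the error by [l] puts it on the scale of the iterate: the step becomes a combination of
   x and eta with weights 1 - sg L and sg l. *)
move=> l0 s0 lL sL1; pose eta := e / l.
have -> : e = l * eta by rewrite mulrC divfK ?gt_eqF.
have -> : sg / l * (l * eta) ^+ 2 = sg * l * eta ^+ 2 by field; rewrite gt_eqF.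
have -> : x - sg * (L * x - l * eta) = (1 - sg * L) * x + (sg * l) * eta by ring.
have : 0 <= sg * l by rewrite mulr_ge0 ?ltW.
have : sg * l <= sg * L by rewrite ler_pM2l.
move: sL1; move: (sg * l) (sg * L) => s t t1 st s0'.
(* [((1-t) x + s eta)^2 = (1-t+s)((1-t) x^2 + s eta^2) - (1-t) s (x - eta)^2] *)
have := mulr_ge0 (mulr_ge0 (_ : 0 <= 1 - t) s0') (sqr_ge0 (x - eta)).
(* The weights sum to 1 - (t - s), not 1; this term and the next absorb the defect and the
   replacement of t by s in the coefficient of x^2. *)
have : 0 <= (t - s) * ((1 - t) * x ^+ 2 + s * eta ^+ 2).
  by rewrite mulr_ge0 ?subr_ge0 // addr_ge0 // mulr_ge0 ?sqr_ge0 ?subr_ge0.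
have : 0 <= (t - s) * x ^+ 2 by rewrite mulr_ge0 ?sqr_ge0 ?subr_ge0.
rewrite subr_ge0 t1 => h1 h2 /(_ isT); lra.
Qed.

(** * Contraction over one epoch, for a fixed batch and starting point *)

Section Contraction.
Variables (R : realType) (n k : nat).
Variables (Gt : 'I_n -> 'M[R]_k) (Q Lam : 'M[R]_k) (l L2 : R).

Local Notation G := (n%:R^-1 *: \sum_t Gt t).
Local Notation P := (invmx Q).

Hypothesis n_gt0 : (0 < n)%N.
Hypothesis k_gt0 : (0 < k)%N.
Hypothesis Qu : Q \in unitmx.
Hypothesis Lam_diag : is_diag_mx Lam.
Hypothesis GE : G = Q *m Lam *m P.
Hypothesis l_gt0 : 0 < l.
Hypothesis l_le : forall i, l <= Lam i i.
Hypothesis Gt_le :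
  forall v, \sum_t sqnorm (Gt t *m v) <= n%:R * (L2 * sqnorm v).

Let sigma := l / (6 * kappa Q ^+ 2 * L2).
Let s := sigma * l.

(** The square of a mean is at most the mean of the squares: the variance term is dropped. *)
Lemma sqnorm_mean_le v : sqnorm (G *m v) <= L2 * sqnorm v.
Proof.
rewrite -(ler_pM2l (_ : 0 < n%:R)) ?ltr0n//.
apply: le_trans (Gt_le v); rewrite (sum_sqnorm_mean _ n_gt0).
rewrite -scalemxAl mulmx_suml lerDl sumr_ge0 // => t _; exact: sqnorm_ge0.
Qed.

Lemma diag_mulmx_entry (x : 'cV[R]_k) i : (Lam *m x) i 0 = Lam i i * x i 0.
Proof.
rewrite mxE (bigD1 i) //= big1 ?addr0 // => j ji.
have /is_diag_mxP Ld := Lam_diag.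
by rewrite Ld ?mul0r// eq_sym.
Qed.

(** Column i of [Q] is an eigenvector of [G] for [Lam i i]; the previous bound is applied to it. *)
Lemma diag_sqr_le i : Lam i i ^+ 2 <= L2.
Proof.
pose v : 'cV[R]_k := Q *m delta_mx i 0.
have v0 : v != 0.
  apply/eqP => v0; have := mulKmx Qu (delta_mx i 0 : 'cV[R]_k).
  rewrite -/v v0 mulmx0 => /matrixP/(_ i 0)/eqP.
  by rewrite !mxE !eqxx eq_sym oner_eq0.
have Gv : G *m v = Lam i i *: v.
  rewrite GE /v -!mulmxA mulKmx// scalemxAr; congr (_ *m _).
  apply/colP => j; rewrite diag_mulmx_entry !mxE eqxx andbT.
  by have [->|] := eqVneq j i; rewrite ?mulr0.
have := sqnorm_mean_le v.
by rewrite Gv sqnormZ ler_pM2r // sqnorm_gt0.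
Qed.

Let i0 : 'I_k := Ordinal k_gt0.

Lemma L2_gt0 : 0 < L2.
Proof.
apply: lt_le_trans (diag_sqr_le i0).
by rewrite exprn_gt0// (lt_le_trans l_gt0).
Qed.

Lemma kappa_sqr_ge1 : 1 <= kappa Q ^+ 2.
Proof. by rewrite exprn_ege1 ?kappa_ge1. Qed.

Lemma sigma_gt0 : 0 < sigma.
Proof.
have k0 := lt_le_trans ltr01 kappa_sqr_ge1.
by rewrite divr_gt0// mulr_gt0 ?L2_gt0// mulr_gt0.
Qed.

Lemma sigma_kappa : sigma * (kappa Q ^+ 2 * L2) = l / 6.
Proof.
rewrite /sigma; field; rewrite gt_eqF ?L2_gt0//=.
have := kappa_sqr_ge1; apply: contraTneq => ->.
by rewrite expr0n /= -ltNge ltr01.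
Qed.

(** After multiplication by [Lam i i], the chain is sigma Lam_i^2 <= sigma kappa^2 L2 = l/6 <=
    Lam_i/6. *)
Lemma sigma_diag_le i : sigma * Lam i i <= 1 / 6.
Proof.
have Li : 0 < Lam i i by rewrite (lt_le_trans l_gt0).
rewrite -(ler_pM2l Li); apply: (@le_trans _ _ (l / 6)); last first.
  by have := l_le i; lra.
rewrite -sigma_kappa mulrCA -expr2 ler_pM2l ?sigma_gt0//.
apply: le_trans (diag_sqr_le i) _.
by rewrite ler_peMl ?kappa_sqr_ge1// ltW ?L2_gt0.
Qed.

Lemma s_gt0 : 0 < s. Proof. by rewrite mulr_gt0 ?sigma_gt0. Qed.

Lemma s_le : s <= 1 / 6.
Proof.
apply: le_trans (sigma_diag_le i0).
by rewrite ler_pM2l ?sigma_gt0.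
Qed.

(** [GSz0] stands for the mini-batch residual G_m z_m - g_m at the start [z0] of the epoch. Keeping
    it an arbitrary vector makes the bounds hold conditionally on any batch; [e] below is then the
    mini-batch error, since G zs = g. *)
Variables (zs z0 GSz0 : 'cV[R]_k).

Let V z := sqnorm (P *m (z - zs)).
Let e := G *m (z0 - zs) - GSz0.

Let step (z : 'cV[R]_k) t := z - sigma *: (Gt t *m (z - z0) + GSz0).

Lemma mean_drift (z : 'cV[R]_k) :
  sqnorm (P *m (z - zs) - sigma *: (P *m (G *m (z - zs) - e)))
  <= (1 - s) * V z + s / l ^+ 2 * sqnorm (P *m e).
Proof.
have PG v : P *m (G *m v) = Lam *m (P *m v) by rewrite GE -!mulmxA mulKmx.
rewrite [P *m (_ - e)]mulmxBr PG.
have -> : s / l ^+ 2 = sigma / l by rewrite /s; field; rewrite gt_eqF.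
rewrite /V; move: (P *m (z - zs)) (P *m e) => x eps.
rewrite /sqnorm !mulr_sumr -big_split; apply: ler_sum => i _ /=.
have -> : (x - sigma *: (Lam *m x - eps)) i 0
    = x i 0 - sigma * ((Lam *m x) i 0 - eps i 0).
  by move: (Lam *m x) => y; rewrite !mxE.
rewrite diag_mulmx_entry; apply: convex_step => //; first exact: sigma_gt0.
apply: le_trans (sigma_diag_le i) _; lra.
Qed.

(** Centering only decreases the sum of squares. Then |P|^2 comes out of the norm, and writing z -
    z0 as Q times a difference contributes |Q|^2, which together give kappa^2. *)
Lemma variance_le (z : 'cV[R]_k) :
  \sum_t sqnorm (P *m ((Gt t - G) *m (z - z0)))
  <= n%:R * (kappa Q ^+ 2 * L2 * (2 * (V z + V z0))).
Proof.
set w := z - z0.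
apply: (@le_trans _ _ (\sum_t opnorm P ^+ 2 * sqnorm (Gt t *m w))).
  apply: (@le_trans _ _ (\sum_t sqnorm (P *m (Gt t *m w)))); last first.
    by apply: ler_sum => t _; apply: sqnorm_mulmx_le.
  rewrite (sum_sqnorm_mean (fun t => P *m (Gt t *m w)) n_gt0).
  rewrite ler_wpDl ?mulr_ge0 ?sqnorm_ge0//.
  apply: ler_sum => t _; rewrite le_eqVlt; apply/orP; left; apply/eqP.
  by rewrite -mulmx_sumr -mulmx_suml scalemxAr scalemxAl -mulmxBr -mulmxBl.
rewrite -mulr_sumr; apply: le_trans (ler_wpM2l (sqr_ge0 _) (Gt_le w)) _.
have wE : w = Q *m (P *m (z - zs) - P *m (z0 - zs)).
  by rewrite -mulmxBr mulKVmx// opprB addrA subrK.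
have wQ : sqnorm w <= opnorm Q ^+ 2 * (2 * (V z + V z0)).
  rewrite wE; apply: le_trans (sqnorm_mulmx_le _ _) _.
  by rewrite ler_wpM2l ?sqr_ge0// sqnormB_le.
have c0 : 0 <= opnorm P ^+ 2 * (n%:R * L2).
  by rewrite mulr_ge0 ?sqr_ge0// mulr_ge0// ltW// L2_gt0.
have := ler_wpM2l c0 wQ; rewrite /kappa; lra.
Qed.

Lemma mean_step (z : 'cV[R]_k) :
  \sum_t V (step z t)
  <= n%:R * ((1 - 2 / 3 * s) * V z
             + (s / 3 * V z0 + s / l ^+ 2 * sqnorm (P *m e))).
Proof.
(* [a] is the mean of the new iterate in the coordinates of [Q], and [y t] is the zero-mean noise of
   sampling t. *)
pose a := P *m (z - zs) - sigma *: (P *m (G *m (z - zs) - e)).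
pose y t := (- sigma) *: (P *m ((Gt t - G) *m (z - z0))).
have -> : \sum_t V (step z t) = \sum_t sqnorm (a + y t).
  apply: eq_bigr => t _; congr sqnorm; rewrite /a /y scaleNr.
  have -> : step z t - zs
      = z - zs - sigma *: (G *m (z - zs) - e + (Gt t - G) *m (z - z0)).
    rewrite /step addrAC; congr (_ - _ *: _); rewrite /e mulmxBl !mulmxBr.
    move: (Gt t *m z) (Gt t *m z0) (G *m z) (G *m z0) (G *m zs).
    by move=> a1 a2 a3 a4 a5; apply/colP => i; rewrite !mxE; ring.
  move: (z - zs) (G *m (z - zs) - e) ((Gt t - G) *m (z - z0)) => x u w.
  by rewrite mulmxBr -scalemxAr mulmxDr scalerDr opprD addrA.
rewrite sum_sqnorm_centered; last first.
  rewrite -scaler_sumr -mulmx_sumr -mulmx_suml sumrB sumr_const card_ord.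
  rewrite -scaler_nat scalerA mulfV ?pnatr_eq0 -?lt0n// scale1r subrr.
  by rewrite mul0mx mulmx0 scaler0.
under [X in _ + X]eq_bigr => t _ do rewrite sqnormZ sqrrN.
rewrite -mulr_sumr.
have Hd := ler_wpM2l (ler0n R n) (mean_drift z).
have Hv := ler_wpM2l (sqr_ge0 sigma) (variance_le z).
apply: le_trans (lerD Hd Hv) _.
(* One factor sigma joins kappa^2 L2 to make l/6, so the noise costs s/3 (V z + V z0), and 1 - s +
   s/3 = 1 - 2s/3. *)
have -> : sigma ^+ 2 * (n%:R * (kappa Q ^+ 2 * L2 * (2 * (V z + V z0))))
  = n%:R * (sigma * (sigma * (kappa Q ^+ 2 * L2)) * (2 * (V z + V z0))) by ring.
rewrite sigma_kappa -mulrDr ler_pM2l ?ltr0n// /s; lra.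
Qed.

Lemma sum_epoch_le K : K%:R = 2 / s ->
  \sum_(w : K.-tuple 'I_n) V (foldl step z0 w)
  <= #|{: K.-tuple 'I_n}|%:R
     * (2 / 3 * V z0 + 2 * ((1 - s) / l ^+ 2) * sqnorm (P *m e)).
Proof.
move=> Ks; have s0 := s_gt0; have s6 := s_le.
pose E := sqnorm (P *m e) / l ^+ 2.
have E0 : 0 <= E by rewrite divr_ge0 ?sqnorm_ge0 ?sqr_ge0.
have V0 : 0 <= V z0 by apply: sqnorm_ge0.
(* The fixed point of the recursion: (2s/3) c = (s/3) V z0 + s E. *)
pose c := 1 / 2 * V z0 + 3 / 2 * E.
apply: le_trans (sum_foldl_contraction (r := 1 - 2 / 3 * s) (c := c) _ _ _ _) _.
- lra.
- move=> z; rewrite card_ord; apply: le_trans (mean_step z) _.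
  by rewrite ler_pM2l ?ltr0n// /c /E; lra.
rewrite card_tuple natrX ler_wpM2l ?exprn_ge0//.
have q3 : (1 - 2 / 3 * s) ^+ K <= 1 / 3.
  by apply: expr_le_third => //; rewrite Ks divfK ?gt_eqF.
have q0 : 0 <= (1 - 2 / 3 * s) ^+ K by rewrite exprn_ge0//; lra.
have -> : 2 * ((1 - s) / l ^+ 2) * sqnorm (P *m e) = 2 * (1 - s) * E.
  by rewrite /E; ring.
rewrite /c; move: q3 q0; move: ((1 - 2 / 3 * s) ^+ K) => q q3 q0.
(* It remains that (1+q)/2 V z0 + 3/2 (1-q) E <= 2/3 V z0 + 2 (1-s) E, from 0 <= q <= 1/3 and s <=
   1/6. *)
have := mulr_ge0 q0 E0.
have : 0 <= (1/3 - q) * V z0 by rewrite mulr_ge0 ?subr_ge0.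
have : 0 <= (1/6 - s) * E by rewrite mulr_ge0 ?subr_ge0.
lra.
Qed.

End Contraction.

(** * Resampling the inner indices of the last epoch *)

Lemma sum_resample (R : pzSemiRingType) (T S : finType) (P : pred T)
    (get : T -> S) (upd : T -> S -> T) (F : T -> R) :
  (forall w s, get (upd w s) = s) -> (forall w, upd w (get w) = w) ->
  (forall w s s', upd (upd w s) s' = upd w s') ->
  (forall w s, P (upd w s) = P w) ->
  \sum_(w | P w) \sum_s F (upd w s) = #|S|%:R * \sum_(w | P w) F w.
Proof.
move=> gu ug uu Pu; pose swap (p : T * S) := (upd p.1 p.2, get p.1).
(* Exchanging the resampled coordinate with the current one is an involution. *)
have swapK : involutive swap by case=> w s; rewrite /swap /= uu ug gu.
rewrite pair_big (reindex_inj (inv_inj swapK)) /=.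
under eq_bigl => p do rewrite Pu.
under eq_bigr => p _ do rewrite uu ug.
rewrite -(pair_big P xpredT (fun w _ => F w)) /= mulr_sumr.
by apply: eq_bigr => w _; rewrite sumr_const mulr_natl.
Qed.

Lemma traj_eq (R : realType) (n d : nat) (phi phi' : 'I_n -> 'cV[R]_d)
    (rw : 'I_n -> R) (gamma sigma : R) K (z0 : 'cV[R]_(d + d))
    (om om' : nat -> epoch_rand n K) m :
  (forall k, (k < m)%N -> om k = om' k) ->
  traj phi phi' rw gamma sigma z0 om m = traj phi phi' rw gamma sigma z0 om' m.
Proof.
elim: m => //= m IH E; rewrite IH ?E// => k km.
by rewrite E // ltnW.
Qed.

Section Resample.
Variables n K m : nat.
Implicit Types (w : Omega n K m) (u : K.-tuple 'I_n).

Definition last_indices w : K.-tuple 'I_n := (w ord_max).2.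

(** The last batch is kept: the mini-batch error depends on it, and only batches enter [valid]. *)
Definition set_last_indices w u : Omega n K m :=
  [ffun i => if i == ord_max then ((w i).1, u) else w i].

Lemma last_indices_set w u : last_indices (set_last_indices w u) = u.
Proof. by rewrite /last_indices ffunE eqxx. Qed.

Lemma set_last_indices_id w : set_last_indices w (last_indices w) = w.
Proof.
apply/ffunP => i; rewrite ffunE; case: eqP => // ->.
by rewrite /last_indices -surjective_pairing.
Qed.

Lemma set_last_indices_set w u u' :
  set_last_indices (set_last_indices w u) u' = set_last_indices w u'.
Proof. by apply/ffunP => i; rewrite !ffunE; case: (i == _). Qed.

Lemma valid_set_last_indices B w u :
  valid B (set_last_indices w u) = valid B w.
Proof.
by rewrite /valid; apply: eq_forallb => i; rewrite ffunE; case: (i == _).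
Qed.

Lemma ext_last w : ext w m = w ord_max.
Proof. by rewrite /ext; congr (w _); apply: val_inj; rewrite /= inordK. Qed.

Lemma ext_set_last_lt w u k :
  (k < m)%N -> ext (set_last_indices w u) k = ext w k.
Proof.
move=> km; rewrite /ext ffunE; case: eqP => // /(congr1 val) /=.
by rewrite inordK ?ltnS 1?ltnW // => E; rewrite E ltnn in km.
Qed.

Lemma ext_set_last w u : ext (set_last_indices w u) m = ((ext w m).1, u).
Proof. by rewrite !ext_last ffunE eqxx. Qed.

End Resample.

Lemma traj_set_last (R : realType) (n d : nat) (phi phi' : 'I_n -> 'cV[R]_d)
    (rw : 'I_n -> R) (gamma sigma : R) K (z0 : 'cV[R]_(d + d)) m
    (w : Omega n K m) u :
  traj phi phi' rw gamma sigma z0 (ext (set_last_indices w u)) m.+1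
  = epoch_step phi phi' rw gamma sigma
      (traj phi phi' rw gamma sigma z0 (ext w) m) ((ext w m).1, u).
Proof.
transitivity (epoch_step phi phi' rw gamma sigma
    (traj phi phi' rw gamma sigma z0 (ext (set_last_indices w u)) m)
    (ext (set_last_indices w u) m)) => //.
by rewrite ext_set_last (traj_eq _ _ _ _ _ _ (ext_set_last_lt w u)).
Qed.

(** * The epoch bound for the saddle-point matrices, and the theorem *)

Section Main.
Variables (R : realType) (n d : nat).
Variables (phi phi' : 'I_n -> 'cV[R]_d) (rw : 'I_n -> R) (gamma : R).
Variables (Q Lam : 'M[R]_(d + d)).
Local Notation G := (Gbar phi phi' gamma).
Local Notation l := (lam_min G).
Local Notation P := (invmx Q).
Local Notation zs := (zstar phi phi' rw gamma).

Hypothesis Au : Ahat phi phi' gamma \in unitmx.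
Hypothesis Cp : posdef (Chat phi).
Hypothesis Qu : Q \in unitmx.
Hypothesis Lam_diag : is_diag_mx Lam.
Hypothesis GE : G = Q *m Lam *m P.
Hypothesis n_gt0 : (0 < n)%N.
Hypothesis d_gt0 : (0 < d)%N.

(** Row i of Q^-1 is a left eigenvector of [G]. *)
Lemma eigenvalue_diag i : eigenvalue G (Lam i i).
Proof.
apply/eigenvalueP; exists (delta_mx 0 i *m P).
  rewrite GE -!mulmxA mulKmx // mulmxA scalemxAl; congr (_ *m _).
  apply/rowP => j; rewrite -rowE !mxE eqxx /=.
  have /is_diag_mxP Ld := Lam_diag.
  have [->|ji] := eqVneq j i; first by rewrite mulr1.
  by rewrite mulr0 Ld // eq_sym.
apply/eqP => /(congr1 (mulmx^~ Q)); rewrite mulmxKV// mul0mx.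
by move=> /matrixP/(_ 0 i)/eqP; rewrite !mxE !eqxx oner_eq0.
Qed.

Lemma lam_min_Gbar_gt0 : 0 < l.
Proof.
apply: lam_min_gt0; last by move=> b; apply: Gbar_eigenvalue_gt0.
by exists (Lam (lshift d (Ordinal d_gt0)) (lshift d (Ordinal d_gt0)));
  apply: eigenvalue_diag.
Qed.

Lemma lam_min_Gbar_le i : l <= Lam i i.
Proof.
by apply: lam_min_le (eigenvalue_diag i) => b; apply: Gbar_eigenvalue_gt0.
Qed.

Variables (sigma : R) (K : nat).
Hypothesis sigmaE : sigma = l / (6 * kappa Q ^+ 2 * LG2 phi phi' gamma).
Hypothesis KE : K%:R = 2 / (sigma * l).

Lemma epoch_bound (z : 'cV[R]_(d + d)) (S : {set 'I_n}) :
  \sum_(u : K.-tuple 'I_n)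
     sqnorm (P *m (epoch_step phi phi' rw gamma sigma z (S, u) - zs))
  <= #|{: K.-tuple 'I_n}|%:R *
     (2 / 3 * sqnorm (P *m (z - zs)) + 2 * ((1 - sigma * l) / l ^+ 2) *
        sqnorm (P *m ((G *m z - gbar phi phi' rw gamma) -
           (Gbatch phi phi' gamma S *m z - gbatch phi phi' rw gamma S)))).
Proof.
have dd : (0 < d + d)%N by rewrite addn_gt0 d_gt0.
(* The fixed-point equation turns the full residual G z - g into G (z - zs). *)
rewrite -(Gbar_zstar rw Au) -mulmxBr.
have := @sum_epoch_le _ _ _ (G_t phi phi' gamma) Q Lam l (LG2 phi phi' gamma)
  n_gt0 dd Qu Lam_diag GE lam_min_Gbar_gt0 lam_min_Gbar_le
  (fun v => mean_sqnorm_G_t phi phi' gamma v n_gt0) zs z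
  (Gbatch phi phi' gamma S *m z - gbatch phi phi' rw gamma S) K.
rewrite -sigmaE => /(_ KE); apply: le_trans.
rewrite le_eqVlt; apply/orP; left; apply/eqP; apply: eq_bigr => u _.
congr (sqnorm (_ *m (_ - _))); rewrite /epoch_step /=.
(* The two updates agree after regrouping as G_t (zj - z) plus the batch residual at z. *)
congr (foldl _ z u); apply/funext => zj; apply/funext => t.
congr (_ - _ *: _); rewrite mulmxBl mulmxBr.
by apply/colP => i; rewrite !mxE; ring.
Qed.

End Main.

Theorem theorem1 (R : realType) (n d : nat)
    (phi phi' : 'I_n -> 'cV[R]_d) (rw : 'I_n -> R) (gamma : R)
    (Q Lam : 'M[R]_(d + d)) (B : nat -> nat) (sigma : R) (K : nat)
    (z0 : 'cV[R]_(d + d)) (m : nat) :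
  Ahat phi phi' gamma \in unitmx ->
  posdef (Chat phi) ->
  Q \in unitmx -> is_diag_mx Lam ->
  Gbar phi phi' gamma = Q *m Lam *m invmx Q ->
  (forall k, (0 < B k <= n)%N) ->
  let lmin := lam_min (Gbar phi phi' gamma) in
  sigma = lmin / (6 * kappa Q ^+ 2 * LG2 phi phi' gamma) ->
  K%:R = 2 / (sigma * lmin) ->
  let z := fun (w : Omega n K m) (k : nat) =>
    traj phi phi' rw gamma sigma z0 (ext w) k in
  let e := fun (w : Omega n K m) =>
    err phi phi' rw gamma sigma z0 (ext w) m in
  let zs := zstar phi phi' rw gamma in
  Exp (@valid n K B m) (fun w => enorm (invmx Q *m (z w m.+1 - zs)) ^+ 2)
  <= 2 / 3 * Exp (@valid n K B m) (fun w => enorm (invmx Q *m (z w m - zs)) ^+ 2)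
     + 2 * ((1 - sigma * lmin) / lmin ^+ 2)
         * Exp (@valid n K B m) (fun w => enorm (invmx Q *m e w) ^+ 2).
Proof.
move=> Au Cp Qu Ld GE Bn lmin sE KE; cbv zeta.
set z := (fun (w : Omega n K m) (k : nat) => traj _ _ _ _ _ _ _ k).
set e := (fun w : Omega n K m => err _ _ _ _ _ _ _ m).
set zs := zstar _ _ _ _.
have n0 : (0 < n)%N by case/andP: (Bn 0%N); apply: leq_trans.
pose E0 w := sqnorm (invmx Q *m (z w m - zs)).
pose Ee w := sqnorm (invmx Q *m e w).
pose c := 2 * ((1 - sigma * lmin) / lmin ^+ 2).
(* All three expectations have the same normalizer, so sums over valid outcomes are compared. *)
suff main : \sum_(w : Omega n K m | valid B w) sqnorm (invmx Q *m (z w m.+1 - zs))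
    <= \sum_(w : Omega n K m | valid B w) (2 / 3 * E0 w + c * Ee w).
  rewrite /Exp -/c (mulrA (2 / 3)) (mulrA c) -mulrDl ler_wpM2r ?invr_ge0 ?ler0n//.
  rewrite !mulr_sumr -big_split /=.
  under eq_bigr => w _ do rewrite enorm_sqr.
  by under [leRHS]eq_bigr => w _ do rewrite !enorm_sqr.
(* In dimension 0 the spectrum is empty and [lam_min] carries no information, but every vector is
   null and both sides vanish. *)
have [d0|d0] := posnP d.
  have sq0 k (v : 'cV[R]_k) : k = 0%N -> sqnorm v = 0.
    by move=> k0; subst k; rewrite /sqnorm big_ord0.
  have dd0 : (d + d = 0)%N by rewrite d0.
  apply: ler_sum => w _.
  by rewrite /E0 /Ee !(sq0 _ _ dd0) !mulr0 addr0.
pose N := #|{: K.-tuple 'I_n}|.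
have N0 : 0 < N%:R :> R.
  by rewrite ltr0n /N card_tuple expn_gt0 card_ord n0.
(* The left side becomes a sum over fresh inner indices inside the sum over outcomes: a conditional
   expectation given the past and the last batch, which [epoch_bound] controls termwise. *)
rewrite -(ler_pM2l N0) -(sum_resample _ (@last_indices_set n K m)
  (@set_last_indices_id n K m) (@set_last_indices_set n K m)
  (@valid_set_last_indices n K m B)).
rewrite mulr_sumr; apply: ler_sum => w _.
have := epoch_bound rw Au Cp Qu Ld GE n0 d0 sE KE (z w m) (ext w m).1.
congr (_ <= _); apply: eq_bigr => u _; congr (sqnorm (_ *m (_ - _))).
by rewrite /z traj_set_last.
Qed.
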